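(* Let $q$ be an odd prime power, let $d$ be even, let $i \in \{1,2\}$ and $Q = Q_i^d$. Let $P \subseteq \mathbb{F}_q^d$. (a) If $S$ is a set of $Q$-spheres all of whose radii are non-zero, then \[\left| I(P,S) - q^{-1}|P|\,|S|\right| \leq (1+o(1))\sqrt{|P|\left(q^{d-1}|S| + q^{d/2-1}|S|^2\right)}.\] (b) If $i = 2$ and $S$ is a set of $Q$-spheres all of radius zero, then \[\left| I(P,S) - q^{-1}|P|\,|S|\right| \leq (1+o(1))\sqrt{|P|\left(q^{d-1}|S| + q^{d/2-1}|S|^2\right)}.\] (c) If $i = 1$ and $S$ is a set of $Q$-spheres all of radius zero, then \[\left| I(P,S) - q^{-1}|P|\,|S|\right| \leq (1+o(1))\sqrt{|P|\left(q^{d-1}|S| + q^{d/2}|S|^2\right)}.\] Here $o(1)$ denotes a quantity depending only on $q$ and $d$ that tends to $0$ as $q \to \infty$ with $d$ fixed (uniformly in $P$ and $S$).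
   Context: $\mathbb{F}_q$ is the finite field with $q$ elements. Fix a non-square $\epsilon \in \mathbb{F}_q$. For even $d$, define quadratic forms on $\mathbb{F}_q^d$ by $Q_1^d(x) = x_1x_2 + x_3x_4 + \cdots + x_{d-1}x_d$ and $Q_2^d(x) = x_1x_2 + x_3x_4 + \cdots + x_{d-3}x_{d-2} + x_{d-1}^2 - \epsilon x_d^2$. For a quadratic form $Q$, the $Q$-sphere with center $y \in \mathbb{F}_q^d$ and radius $r \in \mathbb{F}_q$ is $\{x \in \mathbb{F}_q^d : Q(x-y) = r\}$; a sphere is specified by its center and radius. For $P \subseteq \mathbb{F}_q^d$ and a set $S$ of spheres, $I(P,S) = \#\{(x,s) \in P \times S : x \in s\}$. *)

(* Defs.v *)
From mathcomp Require Import all_boot all_order all_algebra.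

Set Implicit Arguments.
Unset Strict Implicit.
Unset Printing Implicit Defensive.

Import GRing.Theory.
Local Open Scope ring_scope.

(* Coordinates are numbered from 0, so the mathematical x_(k+1) is nat_coord x k;
   it is 0 by convention when k is out of range. *)
Definition nat_coord (R : nzRingType) (d : nat) (x : 'rV[R]_d) (k : nat) : R :=
  oapp (x 0) 0 (insub k : option 'I_d).

Definition Q1 (R : nzRingType) (d : nat) (x : 'rV[R]_d) : R :=
  \sum_(0 <= k < d./2) nat_coord x k.*2 * nat_coord x k.*2.+1.

(* Meaningful for d even and positive. *)
Definition Q2 (R : nzRingType) (eps : R) (d : nat) (x : 'rV[R]_d) : R :=
  \sum_(0 <= k < d./2.-1) nat_coord x k.*2 * nat_coord x k.*2.+1
    + nat_coord x (d - 2) ^+ 2 - eps * nat_coord x (d - 1) ^+ 2.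

(* The index i is only meant to range over {1, 2}. *)
Definition Qform (R : nzRingType) (eps : R) (i d : nat) (x : 'rV[R]_d) : R :=
  if i == 1%N then Q1 x else Q2 eps x.
Arguments Qform [R] eps i d x.

(* A sphere is given by its center s.1 and its radius s.2, so that spheres
   with different parameters count as different even if they have the same
   points. *)
Definition sphere (F : finFieldType) (d : nat) (Q : 'rV[F]_d -> F)
    (s : 'rV[F]_d * F) : {set 'rV[F]_d} :=
  [set x | Q (x - s.1) == s.2].

Definition incidences (F : finFieldType) (d : nat) (Q : 'rV[F]_d -> F)
    (P : {set 'rV[F]_d}) (S : {set 'rV[F]_d * F}) : nat :=
  #|[set xs in setX P S | xs.1 \in sphere Q xs.2]|.

(* Main.v *)
(* Cauchy-Schwarz over P reduces the theorem to the second moment, over all points x,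
   of the discrepancies [x \in s] - 1/q summed over s in S, i.e. to bounding the
   covariances of pairs of spheres. The intersection of two spheres with distinct
   centers is a hyperplane section of a sphere; summing the sizes of the level sets of
   Q over the translates by multiples of the difference c of the centers expresses its
   size through the number Z of roots of an explicit polynomial a w^2 + m w + r:
   it is q^(d-2) + sigma q^(d/2-1) (Z - 1), with sigma = 1 for Q1 and sigma = -1 for Q2.
   The level sets of Q are counted by splitting off
   hyperbolic planes. For x^2 - eps y^2, multiplicativity of the norm shows that all
   nonzero values are taken equally often. *)
Require Import Defs.
From mathcomp Require Import all_boot all_order all_algebra fingroup cyclic ring lra.
From mathcomp Require Import all_classical all_reals all_analysis.

Set Implicit Arguments.
Unset Strict Implicit.
Unset Printing Implicit Defensive.

Import Order.TTheory GRing.Theory Num.Theory.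
Import numFieldNormedType.Exports.
Local Open Scope ring_scope.

(** * Cauchy-Schwarz and second moments of finite families *)

Section SecondMoment.
Variable R : realFieldType.

Lemma card_sum_mem (T : finType) (A : {pred T}) :
  #|A|%:R = \sum_x (x \in A)%:R :> R.
Proof.
rewrite -sum1_card natr_sum [RHS](bigID (mem A)) /=.
rewrite [X in _ + X]big1 ?addr0 => [|i /negPf->//].
by apply: eq_bigr => i ->.
Qed.

(** The nonnegative sum of [(n * g x - t) ^+ 2] over [P] gives Cauchy-Schwarz on [P]. Enlarging the
    sum of squares to all of [T] discards the structure of [P]. *)
Lemma cauchy_schwarz_card (T : finType) (P : {pred T}) (g : T -> R) :
  (\sum_(x in P) g x) ^+ 2 <= #|P|%:R * \sum_x g x ^+ 2.
Proof.
set t := \sum_(x in P) g x; set n : R := #|P|%:R.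
have sub : \sum_(x in P) g x ^+ 2 <= \sum_x g x ^+ 2.
  rewrite [leRHS](bigID (mem P)) /= lerDl; apply: sumr_ge0 => x _; exact: sqr_ge0.
have n0 : 0 <= n by rewrite ler0n.
apply: le_trans (ler_wpM2l n0 sub).
have [n_eq0|n_neq0] := eqVneq n 0.
  have /eqP/card0_eq P0 : #|P| == 0%N by rewrite -(pnatr_eq0 R) -/n n_eq0.
  by rewrite /t !big_pred0 // expr0n mulr0.
have n_gt0 : 0 < n by rewrite lt_def n_neq0.
have : 0 <= \sum_(x in P) (n * g x - t) ^+ 2 by apply: sumr_ge0 => x _; exact: sqr_ge0.
have -> : \sum_(x in P) (n * g x - t) ^+ 2 =
    n * (n * (\sum_(x in P) g x ^+ 2) - t ^+ 2).
  rewrite (eq_bigr (fun x => n ^+ 2 * g x ^+ 2 + (- (2 * n * t) * g x + t ^+ 2)));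
    last by move=> x _; ring.
  rewrite !big_split /= sumr_const -!mulr_sumr -/t.
  rewrite -[X in _ + (_ + X)]mulr_natl -/n; ring.
by rewrite pmulr_rge0 // subr_ge0.
Qed.

(** Expand the square and exchange sums. Allowing [D + O] on the diagonal completes the count of
    off-diagonal pairs to the full square of [#|S|]. *)
Lemma second_moment_le (T U : finType) (S : {pred U}) (f : U -> T -> R) (D O : R) :
  (forall s, s \in S -> \sum_x f s x * f s x <= D + O) ->
  (forall s t, s \in S -> t \in S -> s != t -> \sum_x f s x * f t x <= O) ->
  \sum_x (\sum_(s in S) f s x) ^+ 2 <= D * #|S|%:R + O * #|S|%:R ^+ 2.
Proof.
move=> diag off.
under eq_bigr => x _ do rewrite expr2 mulr_suml.
rewrite exchange_big /=.
have -> : D * #|S|%:R + O * #|S|%:R ^+ 2 = \sum_(s in S) (D + O * #|S|%:R).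
  by rewrite sumr_const -mulr_natr; ring.
apply: ler_sum => s sS; under eq_bigr => x _ do rewrite mulr_sumr.
rewrite exchange_big (bigD1 s) //=.
have -> : O * #|S|%:R = \sum_(t in S) O by rewrite sumr_const mulr_natr.
rewrite [in leRHS](bigD1 s) //= addrA.
apply: lerD; first exact: diag.
by apply: ler_sum => t /andP[tS ts]; apply: off => //; rewrite eq_sym.
Qed.

End SecondMoment.

(** * Level sets of quadratic forms and their hyperplane sections *)

Section QuadraticForms.
Variables (R : realFieldType) (F : finFieldType).
Local Notation q := (#|F|%:R : R).

Lemma q_gt1 : 1 < q.
Proof. by rewrite ltr1n card_finNzRing_gt1. Qed.
Lemma q_gt0 : 0 < q. Proof. exact: lt_trans q_gt1. Qed.

Lemma sum_const_card (a : R) : \sum_(w : F) a = q * a.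
Proof. by rewrite sumr_const mulr_natl. Qed.

Definition level (T : finType) (f : T -> F) (r : F) : R := \sum_x (f x == r)%:R.

Lemma level_bij (T U : finType) (h : U -> T) (f : T -> F) r :
  bijective h -> level (f \o h) r = level f r.
Proof. by move=> hb; rewrite /level [RHS](reindex h) //; exact: onW_bij. Qed.

Lemma sum_level (T : finType) (f : T -> F) : \sum_r level f r = #|T|%:R.
Proof.
rewrite exchange_big /= -sum1_card natr_sum; apply: eq_bigr => x _.
rewrite (bigD1 (f x)) //= eqxx big1 ?addr0 // => r.
by rewrite eq_sym => /negPf->.
Qed.

(** [B] is the polar form: [w = 1] forces B(x, c) = Q(x + c) - Q(x) - Q(c). It is therefore
    symmetric, and linearity in one argument gives bilinearity. *)
Definition nondegenerate_quadratic d (Q : 'rV[F]_d -> F) : Prop :=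
  exists B : 'rV[F]_d -> 'rV[F]_d -> F,
    [/\ forall w x c, Q (x + w *: c) = Q x + w * B x c + w ^+ 2 * Q c,
        forall c, scalar (B^~ c)
      & forall c, c != 0 -> exists x, B x c != 0].

(** The level sizes of a hyperbolic ([sigma = 1]) or elliptic ([sigma = -1]) form in dimension 2k.
    The factor [q] on the left avoids the exponent k - 1, so that [k = 0] can start an induction. *)
Definition has_type (sigma : R) (k : nat) (T : finType) (Q : T -> F) : Prop :=
  forall r, q * level Q r = q ^+ k.*2 + sigma * q ^+ k * (q * (r == 0)%:R - 1).

(** Translation by a suitable multiple of [x0] carries any level set to any other, so the [q] levels
    share the space equally. *)
Lemma level_scalar d (f : 'rV[F]_d -> F) m :
  scalar f -> (exists x, f x != 0) -> q * level f m = q ^+ d.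
Proof.
move=> fl [x0 fx0].
have lev r : level f r = level f m.
  rewrite -[RHS](@level_bij _ _ (+%R ((m - r) / f x0 *: x0))); last first.
    by exists (+%R (- ((m - r) / f x0 *: x0))) => x; rewrite ?addKr ?addNKr.
  apply: eq_bigr => x _ /=; rewrite fl divfK //.
  by rewrite -subr_eq0 -[in RHS]subr_eq0; congr (nat_of_bool (_ == _))%:R; ring.
have := sum_level f; rewrite (eq_bigr (fun=> level f m)) // sumr_const.
by rewrite card_mx mul1n natrX => <-; rewrite -[RHS]mulr_natl.
Qed.

Lemma sum_affine_roots (a b : F) :
  \sum_w (a + w * b == 0)%:R
  = 1 - (b == 0)%:R + q * ((b == 0) && (a == 0))%:R :> R.
Proof.
have [->|b0] /= := eqVneq b 0.
  under eq_bigr => w _ do rewrite mulr0 addr0.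
  by rewrite sumr_const -[LHS]mulr_natl subrr add0r.
rewrite (bigD1 (- a / b)) //= divfK // subrr eqxx big1 ?mulr0 ?subr0 //.
move=> w wn; case: eqP => // /eqP; rewrite addr_eq0 -eqr_oppLR => /eqP E.
by move: wn; rewrite E mulfK // eqxx.
Qed.

(** Roots are counted without multiplicity, and the polynomial may vanish identically, in which case
    the count is [q]. *)
Definition quadratic_roots (a m r : F) : R := \sum_w (r + w * m + w ^+ 2 * a == 0)%:R.

(* Summing the sizes of the level sets r + w m + w^2 Q c of Q over the translates
   by w c counts the pairs (w, x) with (Q x - r) + w (B x c - m) = 0. *)
Lemma level_hyperplane_section sigma k (Q : 'rV[F]_k.*2 -> F) B c r m :
  (forall w x c, Q (x + w *: c) = Q x + w * B x c + w ^+ 2 * Q c) ->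
  (forall c, scalar (B^~ c)) ->
  (forall c, c != 0 -> exists x, B x c != 0) ->
  has_type sigma k Q -> c != 0 ->
  q ^+ 2 * \sum_x ((Q x == r) && (B x c == m))%:R
  = q ^+ k.*2 + sigma * q ^+ k.+1 * (quadratic_roots (Q c) m r - 1).
Proof.
move=> QB Bl Bn Qt c0.
set N := \sum_x _.
have E1 : \sum_w \sum_x (Q (x + w *: c) == r + w * m + w ^+ 2 * Q c)%:R =
    \sum_w level Q (r + w * m + w ^+ 2 * Q c) :> R.
  apply: eq_bigr => w _; rewrite -[RHS](@level_bij _ _ (+%R (w *: c))); last first.
    by exists (+%R (- (w *: c))) => x; rewrite ?addKr ?addNKr.
  by apply: eq_bigr => x _; rewrite /= addrC.
(* The quadratic terms in [w] cancel. A point with [B x c != m] admits exactly one [w]; any other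
   point admits all [w] or none, according to whether [Q x = r]. *)
have E2 : \sum_w \sum_x (Q (x + w *: c) == r + w * m + w ^+ 2 * Q c)%:R =
    q ^+ k.*2 - level (B^~ c) m + q * N.
  rewrite exchange_big /= mulr_sumr.
  have -> : q ^+ k.*2 = \sum_(x : 'rV[F]_k.*2) 1 :> R.
    by rewrite sumr_const card_mx mul1n natrX.
  rewrite -sumrB -big_split /=; apply: eq_bigr => x _.
  rewrite -(subr_eq0 (B x c)) -(subr_eq0 (Q x)) andbC -sum_affine_roots.
  apply: eq_bigr => w _; rewrite QB -subr_eq0.
  by congr (nat_of_bool (_ == _))%:R; ring.
have E3 := level_scalar m (Bl c) (Bn c c0).
have E4 : q * (\sum_w level Q (r + w * m + w ^+ 2 * Q c)) =
    q * q ^+ k.*2 + sigma * q ^+ k * (q * quadratic_roots (Q c) m r - q).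
  rewrite mulr_sumr (eq_bigr _ (fun w _ => Qt _)) big_split /= -mulr_sumr sumrB.
  by rewrite -mulr_sumr !sum_const_card mulr1.
rewrite -E1 E2 in E4.
have -> : q ^+ 2 * N =
    q * (q ^+ k.*2 - level (B^~ c) m + q * N) - q * q ^+ k.*2 + q * level (B^~ c) m.
  by ring.
by rewrite E4 E3 exprS; ring.
Qed.

Lemma quadratic_roots_ge0 a m r : 0 <= quadratic_roots a m r.
Proof. by apply: sumr_ge0 => w _; rewrite ler0n. Qed.

Lemma quadratic_roots_le_card a m r : quadratic_roots a m r <= q.
Proof.
rewrite -[leRHS]mulr1 -sum_const_card; apply: ler_sum => w _; by rewrite lern1 leq_b1.
Qed.

(** A nonzero constant term makes the polynomial nonzero, and its degree is at most 2. *)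
Lemma quadratic_roots_le2 a m r : r != 0 -> quadratic_roots a m r <= 2.
Proof.
move=> r0; pose p := Poly [:: r; m; a].
have pE w : p.[w] = r + w * m + w ^+ 2 * a.
  by rewrite horner_Poly /=; ring.
have p0 : p != 0.
  by apply: contraNneq r0 => p0; move: (pE 0); rewrite p0 horner0 => ->; apply/eqP; ring.
have -> : quadratic_roots a m r = #|root p|%:R.
  rewrite card_sum_mem; apply: eq_bigr => w _.
  by rewrite /in_mem /= /root pE.
rewrite ler_nat cardE -ltnS.
apply: leq_trans (max_poly_roots p0 _ (enum_uniq _)) (size_Poly _).
by apply/allP => w; rewrite mem_enum.
Qed.

(** The polynomial is a w (w + 1), with roots 0 and -1; it arises from two spheres of radius
    zero. *)
Lemma quadratic_roots_ge2 a : 2 <= quadratic_roots a a 0.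
Proof.
rewrite /quadratic_roots (bigD1 0) //= (bigD1 (-1)) /=; last by rewrite oppr_eq0 oner_eq0.
have -> : (0 + 0 * a + 0 ^+ 2 * a == 0) by apply/eqP; ring.
have -> : (0 + -1 * a + (-1) ^+ 2 * a == 0) by apply/eqP; ring.
by rewrite addrA lerDl; apply: sumr_ge0 => w _; rewrite ler0n.
Qed.

Lemma q_ge3 : odd #|F| -> 3 <= q.
Proof. by have := card_finNzRing_gt1 F; rewrite (ler_nat R 3); case: #|F| => [|[|[]]]. Qed.

End QuadraticForms.

(** * Splitting off the first two coordinates *)

Section Coordinates.
Variable F : finFieldType.

Lemma nat_coord_row n (f : nat -> F) k :
  nat_coord (\row_(i < n) f i) k = if (k < n)%N then f k else 0.
Proof. by rewrite /nat_coord; case: insubP => [i -> <-|/negPf->] //=; rewrite mxE. Qed.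

Lemma nat_coord_ord n (x : 'rV[F]_n) (i : 'I_n) : nat_coord x i = x 0 i.
Proof. by rewrite /nat_coord valK. Qed.

Lemma nat_coord_out n (x : 'rV[F]_n) k : (n <= k)%N -> nat_coord x k = 0.
Proof. by rewrite leqNgt /nat_coord; case: insubP => // i ->. Qed.

Lemma nat_coord_inj n (x y : 'rV[F]_n) :
  (forall k, (k < n)%N -> nat_coord x k = nat_coord y k) -> x = y.
Proof. by move=> xy; apply/rowP => i; rewrite -!nat_coord_ord xy. Qed.

Lemma nat_coord0 n k : nat_coord (0 : 'rV[F]_n) k = 0.
Proof. by rewrite /nat_coord; case: insubP => [i _ _|_] //=; rewrite mxE. Qed.

Lemma nat_coordD n (x y : 'rV[F]_n) k :
  nat_coord (x + y) k = nat_coord x k + nat_coord y k.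
Proof. by rewrite /nat_coord; case: insubP => [i _ _|_] /=; rewrite ?mxE ?addr0. Qed.

Lemma nat_coordZ n a (x : 'rV[F]_n) k : nat_coord (a *: x) k = a * nat_coord x k.
Proof. by rewrite /nat_coord; case: insubP => [i _ _|_] /=; rewrite ?mxE ?mulr0. Qed.

Definition tail2 d (x : 'rV[F]_d.+2) : 'rV[F]_d := \row_(i < d) nat_coord x i.+2.

(** Reading the entries from a list with default 0 matches the convention of [nat_coord] at indices
    out of range. *)
Definition cons2 d (u : F * F * 'rV[F]_d) : 'rV[F]_d.+2 :=
  \row_(i < d.+2) nth 0 [:: u.1.1, u.1.2 & [seq nat_coord u.2 j | j <- iota 0 d]] i.

Lemma nat_coord_tail2 d (x : 'rV[F]_d.+2) k : nat_coord (tail2 x) k = nat_coord x k.+2.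
Proof.
rewrite (nat_coord_row d (fun i => nat_coord x i.+2)); case: ltnP => // dk.
by rewrite nat_coord_out.
Qed.

Lemma nat_coord_cons2 d (u : F * F * 'rV[F]_d) k :
  nat_coord (cons2 u) k =
  nth 0 [:: u.1.1, u.1.2 & [seq nat_coord u.2 j | j <- iota 0 d]] k.
Proof.
rewrite (nat_coord_row _ (nth 0 _)); case: ltnP => // dk.
by rewrite nth_default //= size_map size_iota.
Qed.

Lemma tail2_cons2 d (u : F * F * 'rV[F]_d) : tail2 (cons2 u) = u.2.
Proof.
apply: nat_coord_inj => k kd; rewrite nat_coord_tail2 nat_coord_cons2 /=.
by rewrite (nth_map 0%N) ?size_iota // nth_iota.
Qed.

Lemma cons2_bij d : bijective (@cons2 d).
Proof.
exists (fun x => (nat_coord x 0, nat_coord x 1, tail2 x)).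
  by move=> u; rewrite tail2_cons2 !nat_coord_cons2; case: u => [[]].
move=> x; apply: nat_coord_inj => k; rewrite nat_coord_cons2.
case: k => [|[|k]] //= kd; rewrite (nth_map 0%N) ?size_iota // nth_iota //.
by rewrite nat_coord_tail2.
Qed.

Lemma tail2D d (x y : 'rV[F]_d.+2) : tail2 (x + y) = tail2 x + tail2 y.
Proof. by apply/rowP => i; rewrite !mxE nat_coordD. Qed.

Lemma tail2Z d a (x : 'rV[F]_d.+2) : tail2 (a *: x) = a *: tail2 x.
Proof. by apply/rowP => i; rewrite !mxE nat_coordZ. Qed.

End Coordinates.

(** * Adding a hyperbolic plane; the form [Q1] *)

Section Planes.
Variables (R : realFieldType) (F : finFieldType).
Local Notation q := (#|F|%:R : R).

(** A nonzero coordinate of [c] in the plane is detected by the other basis vector of the plane; if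
    both vanish, the tail of [c] is nonzero. *)
Lemma nondegenerate_hyperbolic d (Q : 'rV[F]_d -> F) (Q' : 'rV[F]_d.+2 -> F) :
  (forall x, Q' x = nat_coord x 0 * nat_coord x 1 + Q (tail2 x)) ->
  nondegenerate_quadratic Q -> nondegenerate_quadratic Q'.
Proof.
move=> Q'E [B [QB Bl Bn]].
exists (fun x c => nat_coord x 0 * nat_coord c 1 + nat_coord x 1 * nat_coord c 0
  + B (tail2 x) (tail2 c)); split.
- by move=> w x c; rewrite !Q'E !(nat_coordD, nat_coordZ, tail2D, tail2Z) QB; ring.
- by move=> c a x y; rewrite !(nat_coordD, nat_coordZ, tail2D, tail2Z) Bl; ring.
have Bl0 c : B 0 c = 0.
  by have := Bl c (-1) 0 0; rewrite scaler0 addr0 mulN1r addNr.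
move=> c c0.
have [c1|c1] := eqVneq (nat_coord c 1) 0; last first.
  exists (cons2 (1, 0, 0)); rewrite !nat_coord_cons2 tail2_cons2 /= Bl0.
  by rewrite mul1r mul0r !addr0.
have [c2|c2] := eqVneq (nat_coord c 0) 0; last first.
  exists (cons2 (0, 1, 0)); rewrite !nat_coord_cons2 tail2_cons2 /= Bl0.
  by rewrite mul1r mul0r add0r addr0.
have /Bn[v Bv] : tail2 c != 0.
  apply: contraNneq c0 => t0; apply/eqP/nat_coord_inj => -[|[|k]] kd;
    by rewrite nat_coord0 ?c1 ?c2 -?nat_coord_tail2 ?t0 ?nat_coord0.
exists (cons2 (0, 0, v)); rewrite !nat_coord_cons2 tail2_cons2 /=.
by rewrite !mul0r !add0r.
Qed.

(** Fix the first coordinate [a]. If [a != 0], then [r - a * b] takes each value once and the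
    [sigma] terms cancel. If [a = 0], the level at [r] is counted [q] times, which turns [q ^+ k]
    into [q ^+ k.+1]. *)
Lemma has_type_hyperbolic sigma k (Q : 'rV[F]_k.*2 -> F) (Q' : 'rV[F]_k.+1.*2 -> F) :
  (forall x, Q' x = nat_coord x 0 * nat_coord x 1 + Q (tail2 x)) ->
  has_type sigma k Q -> has_type (sigma : R) k.+1 Q'.
Proof.
move=> Q'E Qt r.
have -> : level R Q' r = \sum_a \sum_b level R Q (r - a * b).
  rewrite -(level_bij R Q' r (cons2_bij _ _)) /level pair_bigA pair_big /=.
  apply: eq_bigr => -[[a b] v] _; rewrite Q'E !nat_coord_cons2 tail2_cons2 /=.
  by rewrite [in RHS]eq_sym subr_eq eq_sym addrC.
rewrite mulr_sumr.
have E a : q * (\sum_b level R Q (r - a * b)) =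
    q * q ^+ k.*2 + sigma * q ^+ k * (q * (1 - (a == 0)%:R + q * ((a == 0) && (r == 0))%:R) - q).
  rewrite mulr_sumr (eq_bigr _ (fun w _ => Qt _)) big_split /= -mulr_sumr sumrB.
  rewrite -mulr_sumr !sum_const_card mulr1 -!(oppr_eq0 a) -sum_affine_roots.
  have -> // : \sum_(b : F) (r - a * b == 0)%:R = \sum_w (r + w * - a == 0)%:R :> R.
  by apply: eq_bigr => b _; congr (nat_of_bool (_ == _))%:R; ring.
rewrite (eq_bigr _ (fun a _ => E a)) big_split /= sum_const_card.
rewrite -mulr_sumr sumrB -mulr_sumr big_split sumrB /= -mulr_sumr !sum_const_card.
have d0 (c : bool) : \sum_(a : F) ((a == 0) && c)%:R = c%:R :> R.
  by rewrite (bigD1 0) //= eqxx big1 ?addr0 // => a /negPf->.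
rewrite d0; under eq_bigr => a _ do rewrite -[a == 0]andbT.
by rewrite d0 /= doubleS !exprS; ring.
Qed.

Lemma Q1_type k :
  nondegenerate_quadratic (@Q1 F k.*2) /\ has_type (1 : R) k (@Q1 F k.*2).
Proof.
elim: k => [|k [IHn IHt]].
  (* The induction starts in dimension 0: the zero form on a single point. *)
  have Q10 x : @Q1 F 0 x = 0 by rewrite /Q1 big_geq.
  split.
    exists (fun _ _ => 0); split=> [w x c|c a x y|c]; rewrite ?Q10 ?mulr0 ?addr0 //.
    by move=> /eqP[]; exact: thinmx0.
  move=> r; rewrite /level (bigD1 0) //= big1 => [|x]; last by rewrite [x]thinmx0 eqxx.
  by rewrite Q10 eq_sym !expr0; ring.
have E x : @Q1 F k.+1.*2 x = nat_coord x 0 * nat_coord x 1 + Q1 (tail2 x).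
  rewrite /Q1 !doubleK big_nat_recl //=; congr (_ + _).
  by apply: eq_bigr => j _; rewrite !nat_coord_tail2.
split; [exact: nondegenerate_hyperbolic E IHn|exact: has_type_hyperbolic E IHt].
Qed.

End Planes.

(** * The anisotropic plane and the form [Q2] *)

Section NormForm.
Variables (R : realFieldType) (F : finFieldType) (eps : F).
Hypothesis odd_q : odd #|F|.
Hypothesis eps_nonsquare : ~ exists a : F, a ^+ 2 = eps.
Local Notation q := (#|F|%:R : R).

(** The norm of u.1 + u.2 sqrt(eps) from the quadratic extension of [F]. *)
Definition norm_form (u : F * F) : F := u.1 ^+ 2 - eps * u.2 ^+ 2.

(** The order of the additive group annihilates 1. As it is odd, [2 = 0] would give [1 = 0]. *)
Lemma two_neq0 : 2 != 0 :> F.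
Proof.
have /= card0 : #|F|%:R = 0 :> F.
  by have := expg_cardG (finset.in_setT (1 : F)); rewrite cardsT FinRing.zmodXgE.
apply/eqP => two0; move: card0; rewrite -(odd_double_half #|F|) odd_q.
by rewrite -mul2n natrD natrM two0 mul0r addr0 => /eqP; rewrite oner_eq0.
Qed.

Lemma eps_neq0 : eps != 0.
Proof. by apply/eqP => e0; apply: eps_nonsquare; exists 0; rewrite expr0n e0. Qed.

Lemma norm_eq0 u : (norm_form u == 0) = (u == (0, 0)).
Proof.
case: u => a b; rewrite /norm_form /=; apply/eqP/eqP => [|[-> ->]]; last by rewrite expr0n mulr0 subr0.
have [->|b0] := eqVneq b 0.
  by rewrite expr0n mulr0 subr0 => /eqP; rewrite expf_eq0 => /andP[_ /eqP->].
move/eqP; rewrite subr_eq0 => /eqP E; case: eps_nonsquare; exists (a / b).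
by rewrite expr_div_n E mulfK // expf_neq0.
Qed.

(** Fibres of squaring have at most two elements, and oddness of [#|F|] excludes equality. *)
Lemma card_squares : (#|F| < 2 * #|[set x ^+ 2 | x : F]|)%N.
Proof.
set A := [set _ | _ in _].
have : (#|F| <= 2 * #|A|)%N.
  rewrite -[leqLHS]sum1_card (partition_big (fun x => x ^+ 2) (mem A)) /=; last first.
    by move=> x _; apply: imset_f.
  have -> : (2 * #|A| = \sum_(y in A) 2)%N by rewrite sum_nat_const mulnC.
  apply: leq_sum => y /imsetP[z _ ->].
  rewrite sum1_card; apply: leq_trans (subset_leq_card _) (card_size [:: z; - z]).
  apply/fintype.subsetP => x xz; rewrite !inE -eqf_sqr; exact: xz.
by rewrite leq_eqVlt => /orP[/eqP E|//]; move: odd_q; rewrite E oddM.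
Qed.

(* Pigeonhole: the squares and the elements [r + eps b ^ 2] both fill more than half of F. *)
Lemma norm_surj r : exists u, norm_form u = r.
Proof.
set A := [set x ^+ 2 | x : F]; pose B := [set r + eps * y | y in A].
have cB : #|B| = #|A|.
  by rewrite card_imset // => x y /addrI; apply: mulfI; exact: eps_neq0.
have : A :&: B != finset.set0.
  apply: contraTneq card_squares => AB0; rewrite -leqNgt mul2n -addnn -{2}cB.
  by rewrite -cardsUI AB0 cards0 addn0 max_card.
move=> /finset.set0Pn[z]; rewrite inE => /andP[/imsetP[a _ ->] /imsetP[_ /imsetP[b _ ->] E]].
by exists (a, b); rewrite /norm_form /= E addrK.
Qed.

(** The map [h] is multiplication by a + b sqrt(eps), an element of norm [r]. It is injective
    because only zero has norm zero. *)
Lemma level_norm_neq0 r : r != 0 -> level R norm_form r = level R norm_form 1.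
Proof.
move=> r0; have [[a b] ab] := norm_surj r.
pose h (u : F * F) := (a * u.1 + eps * b * u.2, b * u.1 + a * u.2).
have hM u : norm_form (h u) = r * norm_form u by rewrite -ab /norm_form /h /=; ring.
have hb : bijective h.
  apply: injF_bij => -[x y] [x' y'] E.
  have : norm_form (h (x - x', y - y')) = 0.
    case: E => /= E1 E2; rewrite /norm_form /h /=.
    have -> : a * (x - x') + eps * b * (y - y') =
      (a * x + eps * b * y) - (a * x' + eps * b * y') by ring.
    have -> : b * (x - x') + a * (y - y') = (b * x + a * y) - (b * x' + a * y') by ring.
    by rewrite E1 E2 !subrr expr0n mulr0 subr0.
  rewrite hM => /eqP; rewrite mulf_eq0 (negPf r0) norm_eq0 /= => /eqP[].
  by move=> /eqP; rewrite subr_eq0 => /eqP-> /eqP; rewrite subr_eq0 => /eqP->.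
rewrite -(level_bij R norm_form r hb); apply: eq_bigr => u _ /=.
by rewrite hM -[X in _ == X](mulr1 r) (inj_eq (mulfI r0)).
Qed.

(** Zero is taken once; the other q^2 - 1 pairs are spread evenly over q - 1 values. *)
Lemma level_norm r : level R norm_form r = q + 1 - q * (r == 0)%:R.
Proof.
have l0 : level R norm_form 0 = 1.
  rewrite /level (bigD1 (0, 0)) //= norm_eq0 eqxx big1 ?addr0 // => u /negPf u0.
  by rewrite norm_eq0 u0.
have [->|r0] := eqVneq r 0; first by rewrite l0 mulr1; ring.
have := sum_level R norm_form; rewrite (bigD1 0) //= l0.
rewrite (eq_bigr (fun=> level R norm_form r)); last first.
  by move=> s s0; rewrite !level_norm_neq0.
have := sum_const_card F (level R norm_form r).
rewrite (bigD1 0) //= => E /eqP; rewrite card_prod natrM -subr_eq0.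
have q1 : q - 1 != 0 by rewrite subr_eq0 gt_eqF // q_gt1.
set t := \sum_(_ | _) _ in E *.
have -> : t = (q - 1) * level R norm_form r by move: E; lra.
have -> : 1 + (q - 1) * level R norm_form r - q * q =
  (q - 1) * (level R norm_form r - (q + 1)) by ring.
by rewrite mulf_eq0 (negPf q1) /= subr_eq0 => /eqP->; rewrite mulr0 subr0.
Qed.

Lemma Q2_type k :
  nondegenerate_quadratic (@Q2 F eps k.+1.*2) /\ has_type (-1 : R) k.+1 (@Q2 F eps k.+1.*2).
Proof.
elim: k => [|k [IHn IHt]].
  have E x : @Q2 F eps 2 x = nat_coord x 0 ^+ 2 - eps * nat_coord x 1 ^+ 2.
    by rewrite /Q2 big_geq ?add0r.
  split.
    (* The polar form is diagonal with entries 2 and -2 eps, both nonzero. *)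
    exists (fun x c => 2 * (nat_coord x 0 * nat_coord c 0) 
                       - 2 * eps * (nat_coord x 1 * nat_coord c 1)); split.
    - by move=> w x c; rewrite !E !(nat_coordD, nat_coordZ); ring.
    - by move=> c a x y; rewrite !(nat_coordD, nat_coordZ); ring.
    move=> c c0; have [c1|c1] := eqVneq (nat_coord c 0) 0.
      exists (cons2 (0, 1, 0)); rewrite !nat_coord_cons2 /= mul0r mulr0 add0r mul1r oppr_eq0.
      rewrite !mulf_eq0 (negPf two_neq0) (negPf eps_neq0) /=.
      apply: contraNneq c0 => c2; apply/eqP/nat_coord_inj => -[|[|k]] // _;
        by rewrite ?c1 ?c2 nat_coord0.
    exists (cons2 (1, 0, 0)); rewrite !nat_coord_cons2 /= mul0r mulr0 subr0 mul1r.
    by rewrite mulf_eq0 (negPf two_neq0).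
  move=> r.
  have -> : level R (@Q2 F eps 2) r = level R norm_form r.
    rewrite -(level_bij R (@Q2 F eps 2) r (cons2_bij _ _)).
    rewrite /level -(pair_bigA _ (fun u v => (Q2 eps (cons2 (u, v : 'rV[F]_0)) == r)%:R)) /=.
    apply: eq_bigr => u _; rewrite (bigD1 0) //= big1 ?addr0; last first.
      by move=> v; rewrite [v]thinmx0 eqxx.
    by rewrite E !nat_coord_cons2.
  by rewrite level_norm; ring.
have E x : @Q2 F eps k.+2.*2 x = nat_coord x 0 * nat_coord x 1 + Q2 eps (tail2 x).
  (* Planes are peeled off at the front, so the last two coordinates remain last and their indices
     drop by two under [tail2]. *)
  have e2 : (k.+2.*2 - 2 = (k.+1.*2 - 2).+2)%N by rewrite !doubleS !subSS !subn0.
  have e1 : (k.+2.*2 - 1 = (k.+1.*2 - 1).+2)%N by rewrite !doubleS !subSS !subn0.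
  rewrite /Q2 (doubleK k.+2) (doubleK k.+1) [k.+2.-1]/= [k.+1.-1]/= big_nat_recl //.
  rewrite e1 e2 !nat_coord_tail2 -!addrA; congr (_ + (_ + _)).
  by apply: eq_bigr => j _; rewrite !nat_coord_tail2.
split; [exact: nondegenerate_hyperbolic E IHn|exact: has_type_hyperbolic E IHt].
Qed.

End NormForm.

(** Since [1 <= c], the factor [c] under the root may be enlarged to [c ^+ 2]. *)
Lemma le_mul_sqrtr (R : rcfType) (c a b : R) :
  1 <= c -> 0 <= b -> a <= c * b -> Num.sqrt a <= c * Num.sqrt b.
Proof.
move=> c1 b0 ab; have c0 : 0 <= c by exact: le_trans c1.
rewrite -[X in X * _](ger0_norm c0) -sqrtr_sqr -sqrtrM ?sqr_ge0 //.
apply: ler_wsqrtr; apply: le_trans ab _.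
by rewrite expr2 -mulrA ler_peMl // mulr_ge0.
Qed.

(** * Covariances of spheres in dimension d = 2(k + 1), with [p] standing for q^(d/2 - 1) *)

Section Spheres.
Variables (R : rcfType) (F : finFieldType) (k : nat).
Variables (Q : 'rV[F]_k.+1.*2 -> F) (sigma : R).
Hypothesis Qn : nondegenerate_quadratic Q.
Hypothesis Qt : has_type sigma k.+1 Q.
Local Notation q := (#|F|%:R : R).
Local Notation p := (q ^+ k).

Let q_neq0 : q != 0. Proof. by rewrite gt_eqF // q_gt0. Qed.

(** Centered at 1/q, the density of the main term, and not at the exact density of the sphere; hence
    level sizes survive in [covarianceE]. *)
Definition discrepancy (s : 'rV[F]_k.+1.*2 * F) x : R := (x \in sphere Q s)%:R - q^-1.

Definition covariance s t : R := \sum_x discrepancy s x * discrepancy t x.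

Lemma level_eq r : level R Q r = p ^+ 2 * q + sigma * p * (q * (r == 0)%:R - 1).
Proof.
apply: (mulfI q_neq0); rewrite Qt -muln2 exprM !exprS; ring.
Qed.

Lemma sum_sphere s : \sum_x (x \in sphere Q s)%:R = level R Q s.2.
Proof.
rewrite -(@level_bij R F _ _ (+%R (- s.1))).
  by apply: eq_bigr => x _; rewrite inE /= addrC.
by exists (+%R s.1) => x; rewrite ?addKr ?addNKr.
Qed.

Lemma covarianceE s t :
  covariance s t = \sum_x ((x \in sphere Q s) && (x \in sphere Q t))%:R
    - q^-1 * (level R Q s.2 + level R Q t.2) + p ^+ 2.
Proof.
rewrite -!sum_sphere mulrDr !mulr_sumr.
have -> : p ^+ 2 = \sum_(x : 'rV[F]_k.+1.*2) q^-1 ^+ 2.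
  rewrite sumr_const card_mx mul1n -[RHS]mulr_natl natrX -muln2 exprM [q ^+ k.+1]exprS.
  by field.
rewrite opprD addrA -!sumrB -big_split /=; apply: eq_bigr => x _.
by rewrite /discrepancy -mulnb natrM; ring.
Qed.

Lemma covariance_diag s :
  covariance s s = p ^+ 2 * q - p ^+ 2 
    + sigma * p * (1 - 2 * q^-1) * (q * (s.2 == 0)%:R - 1).
Proof.
rewrite covarianceE; under eq_bigr do rewrite andbb.
by rewrite sum_sphere level_eq; field.
Qed.

(** Distinct spheres with a common center have different radii, so they are disjoint. *)
Lemma covariance_concentric s t : s.1 = t.1 -> s != t ->
  covariance s t = - p ^+ 2
    - sigma * p * ((s.2 == 0)%:R + (t.2 == 0)%:R - 2 * q^-1).
Proof.
move=> st1 st; rewrite covarianceE big1 => [|x _].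
  by rewrite !level_eq; field.
case: andP => // -[]; rewrite !inE st1 => /eqP E /eqP E'.
by case/eqP: st; case: s t st1 E E' => [a r] [b r'] /= -> -> ->.
Qed.

(** Here [a] is [Q (t.1 - s.1)]. After recentering at [s.1], the second equation becomes linear on
    the first sphere, and the main terms [p ^+ 2] of the intersection and the levels cancel. *)
Lemma covariance_distinct_centers s t : s.1 != t.1 -> exists a,
  covariance s t = sigma * p *
    (quadratic_roots R a (s.2 + a - t.2) s.2 - 1 - (s.2 == 0)%:R - (t.2 == 0)%:R + 2 * q^-1).
Proof.
move=> st; have [B [QB Bl Bn]] := Qn.
have c0 : t.1 - s.1 != 0 by rewrite subr_eq0 eq_sym.
set c := t.1 - s.1 in c0 *; exists (Q c).
have := level_hyperplane_section s.2 (s.2 + Q c - t.2) QB Bl Bn Qt c0.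
set N := \sum_x _ => EN.
rewrite covarianceE.
have -> : \sum_x ((x \in sphere Q s) && (x \in sphere Q t))%:R = N.
  rewrite (reindex (fun x => x + s.1)) /=; last first.
    by apply: onW_bij; exists (fun x => x - s.1) => x; rewrite ?addrK ?subrK.
  apply: eq_bigr => x _; rewrite !inE addrK.
  have -> : x + s.1 - t.1 = x + (-1) *: c.
    by rewrite scaleN1r opprB addrA.
  rewrite QB; case: eqP => //= <-; congr (nat_of_bool _)%:R.
  rewrite -subr_eq0 -[RHS]subr_eq0 -[RHS]oppr_eq0.
  by congr (_ == _); ring.
apply: (mulfI (expf_neq0 2 q_neq0)).
have qE : q ^+ k.+1.*2 = (q * p) ^+ 2 by rewrite -muln2 exprM [q ^+ k.+1]exprS.
by rewrite mulrDr mulrBr EN !level_eq qE !(exprS q k.+1, exprS q k); field.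
Qed.

(** The error is the sum of [discrepancy] over pairs in [P] and [S], to which Cauchy-Schwarz over
    [P] applies. *)
Lemma incidences_second_moment (P : {set 'rV[F]_k.+1.*2}) (S : {set 'rV[F]_k.+1.*2 * F})
    (D O : R) :
  (forall s, s \in S -> covariance s s <= D + O) ->
  (forall s t, s \in S -> t \in S -> s != t -> covariance s t <= O) ->
  `|(incidences Q P S)%:R - q^-1 * #|P|%:R * #|S|%:R|
  <= Num.sqrt (#|P|%:R * (D * #|S|%:R + O * #|S|%:R ^+ 2)).
Proof.
move=> diag off.
have -> : (incidences Q P S)%:R - q^-1 * #|P|%:R * #|S|%:R =
    \sum_(x in P) \sum_(s in S) discrepancy s x.
  under eq_bigr => x _ do rewrite sumrB.
  rewrite sumrB !sumr_const; congr (_ - _); last first.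
    by rewrite -(mulr_natr _ #|P|) -(mulr_natr _ #|S|); ring.
  rewrite /incidences -sum1_card natr_sum pair_big /= [RHS](bigID (fun u => u.1 \in sphere Q u.2)) /=.
  rewrite [X in _ = _ + X]big1 ?addr0 => [|u /andP[_ /negPf->] //].
  apply: eq_big => [u|u]; first by rewrite !inE.
  by rewrite !inE => /andP[_ ->].
rewrite -sqrtr_sqr ler_wsqrtr //.
apply: le_trans (cauchy_schwarz_card _ _) _.
by apply: ler_wpM2l; rewrite ?ler0n //; exact: second_moment_le.
Qed.

(** * Covariance bounds by radius and type, and the resulting incidence bounds *)

Hypothesis odd_q : odd #|F|.

Let p_ge0 : 0 <= p. Proof. by rewrite exprn_ge0. Qed.
Let inv_q_ge0 : 0 <= q^-1. Proof. by rewrite invr_ge0. Qed.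
Let inv_q_le : 3 * q^-1 <= 1.
Proof. by rewrite ler_pdivrMr ?mul1r ?q_ge3 // q_gt0. Qed.
Let p_le_sqr : p <= p ^+ 2.
Proof. by rewrite expr2 ler_peMr // exprn_ege1 // ltW // q_gt1. Qed.

(** The [sigma] term is at most [p] in absolute value and is absorbed by [- p ^+ 2]. *)
Lemma covariance_diag_nonzero_radius s : sigma = 1 \/ sigma = -1 -> s.2 != 0 ->
  covariance s s <= p ^+ 2 * q.
Proof.
move=> sg /negPf s0; rewrite covariance_diag s0 mulr0.
have : 0 <= q^-1 * p by exact: mulr_ge0.
have : 0 <= (1 - 3 * q^-1) * p by rewrite mulr_ge0 // subr_ge0.
move: p_ge0 p_le_sqr; move: (q ^+ k) (q^-1) => x u.
by case: sg => -> /=; nra.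
Qed.

(** For distinct centers the covariance is sigma p (Z - 1 + 2/q) with Z between 0 and 2, which works
    for both signs. *)
Lemma covariance_off_nonzero_radius s t : sigma = 1 \/ sigma = -1 ->
  s.2 != 0 -> t.2 != 0 -> s != t -> covariance s t <= p * (1 + 2 * q^-1).
Proof.
move=> sg s0 t0 st.
have pu : 0 <= q^-1 * p by exact: mulr_ge0.
have [st1|/covariance_distinct_centers[a ->]] := eqVneq s.1 t.1.
  rewrite covariance_concentric // (negPf s0) (negPf t0) /=.
  by rewrite addr0 sub0r; move: p_ge0 p_le_sqr pu; case: sg => -> ??; nra.
rewrite (negPf s0) (negPf t0) /=.
have := quadratic_roots_ge0 R a (s.2 + a - t.2) s.2.
have := quadratic_roots_le2 R a (s.2 + a - t.2) s0.
move: (quadratic_roots _ _ _ _) => z z2 z0.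
have : 0 <= p * z by exact: mulr_ge0.
have : 0 <= p * (2 - z) by rewrite mulr_ge0 // subr_ge0.
by case: sg => ->; nra.
Qed.

Lemma covariance_diag_zero_radius_elliptic s : sigma = -1 -> s.2 = 0 ->
  covariance s s <= p ^+ 2 * q.
Proof.
move=> sg s0; rewrite covariance_diag sg s0 eqxx mulr1.
(* The factor 1 - 2/q is split so that [inv_q_le] shows it to be nonnegative. *)
have : 0 <= p * ((1 - 3 * q^-1 + q^-1) * (q - 1)).
  have q1 := q_gt1 R F; rewrite mulr_ge0 ?mulr_ge0 ?subr_ge0 ?(ltW q1) //.
  by move: inv_q_ge0 inv_q_le; lra.
have -> : -1 * p * (1 - 2 * q^-1) * (q - 1) = - (p * ((1 - 3 * q^-1 + q^-1) * (q - 1))) by ring.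
by have := sqr_ge0 p; move: (_ * (_ * (q - 1))) => y; lra.
Qed.

Lemma zero_radius_distinct_centers (s t : 'rV[F]_k.+1.*2 * F) :
  s.2 = 0 -> t.2 = 0 -> s != t -> s.1 != t.1.
Proof. by case: s t => [a r] [b r'] /= -> ->; apply: contraNneq => ->. Qed.

(** The covariance is p (3 - Z - 2/q), and the two roots 0 and -1 give Z at least 2. *)
Lemma covariance_off_zero_radius_elliptic s t : sigma = -1 ->
  s.2 = 0 -> t.2 = 0 -> s != t -> covariance s t <= p.
Proof.
move=> sg s0 t0 st; have := zero_radius_distinct_centers s0 t0 st.
move=> /covariance_distinct_centers[a ->].
rewrite sg s0 t0 eqxx add0r subr0 /=.
have := quadratic_roots_ge2 R a.
move: (quadratic_roots _ _ _ _) => z z2.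
have : 0 <= p * (z - 2) by rewrite mulr_ge0 // subr_ge0.
have : 0 <= q^-1 * p by exact: mulr_ge0.
by move: (q ^+ k) (q^-1) => x u; nra.
Qed.

Lemma covariance_diag_zero_radius_hyperbolic s : sigma = 1 -> s.2 = 0 ->
  covariance s s <= p ^+ 2 * q + p * q.
Proof.
move=> sg s0; rewrite covariance_diag sg s0 eqxx mulr1.
have -> : 1 * p * (1 - 2 * q^-1) * (q - 1) = p * q - 3 * p + 2 * (q^-1 * p).
  by field.
have : 0 <= (1 - 3 * q^-1) * p by rewrite mulr_ge0 // subr_ge0.
have := sqr_ge0 p; move: p_ge0.
by move: (q ^+ k) (q^-1) => x u; nra.
Qed.

(** The covariance is p (Z - 3 + 2/q). If the difference of the centers is isotropic, the polynomial
    vanishes and Z = q; this is the source of the larger power of [q]. *)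
Lemma covariance_off_zero_radius_hyperbolic s t : sigma = 1 ->
  s.2 = 0 -> t.2 = 0 -> s != t -> covariance s t <= p * q.
Proof.
move=> sg s0 t0 st; have := zero_radius_distinct_centers s0 t0 st.
move=> /covariance_distinct_centers[a ->].
rewrite sg s0 t0 eqxx mul1r /=.
apply: ler_wpM2l => //.
have := quadratic_roots_le_card R a (0 + a - 0) 0.
by move: inv_q_le; lra.
Qed.

Lemma incidences_le_of_covariance (P : {set 'rV[F]_k.+1.*2})
    (S : {set 'rV[F]_k.+1.*2 * F}) (O : R) :
  0 <= O ->
  (forall s, s \in S -> covariance s s <= p ^+ 2 * q + O * (1 + 2 * q^-1)) ->
  (forall s t, s \in S -> t \in S -> s != t -> covariance s t <= O * (1 + 2 * q^-1)) ->
  `|(incidences Q P S)%:R - q^-1 * #|P|%:R * #|S|%:R|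
  <= (1 + 2 * q^-1) *
     Num.sqrt (#|P|%:R * (q ^+ (k.+1.*2 - 1) * #|S|%:R + O * #|S|%:R ^+ 2)).
Proof.
move=> O0 diag off; apply: le_trans (incidences_second_moment P diag off) _.
have -> : (k.+1.*2 - 1 = k.*2.+1)%N by rewrite doubleS subSS subn0.
have -> : q ^+ k.*2.+1 = p ^+ 2 * q by rewrite exprSr -muln2 exprM.
have c1 : 1 <= 1 + 2 * q^-1 by rewrite lerDl mulr_ge0.
have A0 : 0 <= p ^+ 2 * q * #|S|%:R by rewrite !mulr_ge0.
apply: le_mul_sqrtr => //.
  by rewrite mulr_ge0 // addr_ge0 // mulr_ge0 // exprn_ge0.
rewrite [leRHS]mulrCA; apply: ler_wpM2l => //.
(* Only the [O] term carries the factor 1 + 2/q; the diagonal term is enlarged by it so that it can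
   be taken out as a common factor. *)
rewrite [leRHS]mulrDr; apply: lerD; first by rewrite ler_peMl.
by rewrite -[leLHS]mulrA mulrCA.
Qed.

Let half_pred : (k.+1.*2./2 - 1)%N = k. Proof. by rewrite doubleK subSS subn0. Qed.
Let le_growth x : 0 <= x -> x <= x * (1 + 2 * q^-1).
Proof. by move=> x0; rewrite ler_peMr // lerDl mulr_ge0. Qed.

Lemma incidences_nonzero_radius (P : {set 'rV[F]_k.+1.*2})
    (S : {set 'rV[F]_k.+1.*2 * F}) :
  sigma = 1 \/ sigma = -1 -> (forall s, s \in S -> s.2 != 0) ->
  `|(incidences Q P S)%:R - q^-1 * #|P|%:R * #|S|%:R|
  <= (1 + 2 * q^-1) * Num.sqrt (#|P|%:R *
       (q ^+ (k.+1.*2 - 1) * #|S|%:R + q ^+ (k.+1.*2./2 - 1) * #|S|%:R ^+ 2)).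
Proof.
move=> sg S0; rewrite half_pred; apply: incidences_le_of_covariance => // [s sS|s t sS tS].
  apply: le_trans (covariance_diag_nonzero_radius sg (S0 s sS)) _.
  by rewrite lerDl; apply: le_trans (le_growth p_ge0).
by apply: covariance_off_nonzero_radius => //; exact: S0.
Qed.

Lemma incidences_zero_radius_elliptic (P : {set 'rV[F]_k.+1.*2})
    (S : {set 'rV[F]_k.+1.*2 * F}) :
  sigma = -1 -> (forall s, s \in S -> s.2 = 0) ->
  `|(incidences Q P S)%:R - q^-1 * #|P|%:R * #|S|%:R|
  <= (1 + 2 * q^-1) * Num.sqrt (#|P|%:R *
       (q ^+ (k.+1.*2 - 1) * #|S|%:R + q ^+ (k.+1.*2./2 - 1) * #|S|%:R ^+ 2)).
Proof.
move=> sg S0; rewrite half_pred; apply: incidences_le_of_covariance => // [s sS|s t sS tS st].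
  apply: le_trans (covariance_diag_zero_radius_elliptic sg (S0 s sS)) _.
  by rewrite lerDl; apply: le_trans (le_growth p_ge0).
apply: le_trans (le_growth p_ge0).
by apply: covariance_off_zero_radius_elliptic => //; exact: S0.
Qed.

Lemma incidences_zero_radius_hyperbolic (P : {set 'rV[F]_k.+1.*2})
    (S : {set 'rV[F]_k.+1.*2 * F}) :
  sigma = 1 -> (forall s, s \in S -> s.2 = 0) ->
  `|(incidences Q P S)%:R - q^-1 * #|P|%:R * #|S|%:R|
  <= (1 + 2 * q^-1) * Num.sqrt (#|P|%:R *
       (q ^+ (k.+1.*2 - 1) * #|S|%:R + q ^+ (k.+1.*2)./2 * #|S|%:R ^+ 2)).
Proof.
move=> sg S0; rewrite doubleK exprSr.
have pq_ge0 : 0 <= p * q by rewrite mulr_ge0.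
apply: incidences_le_of_covariance => // [s sS|s t sS tS st].
  apply: le_trans (covariance_diag_zero_radius_hyperbolic sg (S0 s sS)) _.
  by rewrite lerD2l le_growth.
apply: le_trans (le_growth pq_ge0).
by apply: covariance_off_zero_radius_hyperbolic => //; exact: S0.
Qed.

End Spheres.

(** * The incidence bounds for both forms *)

Local Open Scope classical_set_scope.

Theorem theorem1p7 (R : realType) :
  exists delta : nat -> nat -> R,
    (forall d : nat, (0 < d)%N -> ~~ odd d ->
       delta q d @[q --> \oo] --> (0 : R)) /\
    (forall (d q : nat) (F : finFieldType) (eps : F) (i : nat)
            (P : {set 'rV[F]_d}),
       (0 < d)%N -> ~~ odd d -> #|F| = q -> odd q ->
       ~ (exists a : F, a ^+ 2 = eps) ->
       (i = 1%N \/ i = 2%N) ->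
       [/\ (forall S : {set 'rV[F]_d * F},
              (forall s, s \in S -> s.2 != 0) ->
              `| (incidences (Qform eps i d) P S)%:R
                 - q%:R^-1 * #|P|%:R * #|S|%:R |
              <= (1 + delta q d)
                 * Num.sqrt (#|P|%:R * (q%:R ^+ (d - 1) * #|S|%:R
                              + q%:R ^+ (d./2 - 1) * #|S|%:R ^+ 2))),
           (i = 2%N -> forall S : {set 'rV[F]_d * F},
              (forall s, s \in S -> s.2 = 0) ->
              `| (incidences (Qform eps i d) P S)%:R
                 - q%:R^-1 * #|P|%:R * #|S|%:R |
              <= (1 + delta q d)
                 * Num.sqrt (#|P|%:R * (q%:R ^+ (d - 1) * #|S|%:R
                              + q%:R ^+ (d./2 - 1) * #|S|%:R ^+ 2)))
         & (i = 1%N -> forall S : {set 'rV[F]_d * F},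
              (forall s, s \in S -> s.2 = 0) ->
              `| (incidences (Qform eps i d) P S)%:R
                 - q%:R^-1 * #|P|%:R * #|S|%:R |
              <= (1 + delta q d)
                 * Num.sqrt (#|P|%:R * (q%:R ^+ (d - 1) * #|S|%:R
                              + q%:R ^+ (d./2) * #|S|%:R ^+ 2)))]).
Proof.
(* The term 2/q comes from the off-diagonal covariances at nonzero radii and is uniform in [d]. *)
exists (fun q _ => 2 * q%:R^-1); split=> [d _ _|].
  (* Shifting the index by one reduces the limit to the harmonic sequence. *)
  have lim0 : 2 * n.+1%:R^-1 @[n --> \oo] --> (2 * 0 : R).
    by apply: cvgM; [exact: cvg_cst|exact: cvg_harmonic].
  by rewrite mulr0 in lim0; rewrite -cvg_shiftS; exact: lim0.
move=> d q F eps i P d0 d_even Fq; move: P; rewrite -Fq => P q_odd epsN i12.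
have [k dE] : exists k, d = k.+1.*2.
  exists d./2.-1; rewrite prednK ?even_halfK // half_gt0.
  by move: d0 d_even; case: (d) => [|[]].
subst d; case: i12 => ->; split=> // [S SP|_ S SP].
- have [Qn Qt] := Q1_type R F k.+1.
  by apply: (incidences_nonzero_radius Qn Qt) => //; left.
- have [Qn Qt] := Q1_type R F k.+1.
  exact: (incidences_zero_radius_hyperbolic Qn Qt).
- have [Qn Qt] := Q2_type R q_odd epsN k.
  by apply: (incidences_nonzero_radius Qn Qt) => //; right.
- have [Qn Qt] := Q2_type R q_odd epsN k.
  exact: (incidences_zero_radius_elliptic Qn Qt).
Qed.
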